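(* Let $I=\{1,\dots,n\}$, let $G=(I,E,\omega)$ be a connected weighted graph, let $\Theta\subset\mathbb{R}^d$ be open with $1\le d\leq n-1$, and let $p\colon\Theta\to\mathcal{P}_+(I)$ be a smooth parametrization whose Jacobi matrix $J_\theta p(\theta)\in\mathbb{R}^{n\times d}$ has rank $d$ for every $\theta\in\Theta$. Equip $\Theta$ with the Riemannian metric $g_\theta(a,b)=a^{\mathsf T}G(\theta)b$, where $$G(\theta)=J_\theta p(\theta)^{\mathsf T}L(p(\theta))^{\dagger}J_\theta p(\theta).$$ Let $F\colon\mathcal{P}_+(I)\to\mathbb{R}$ be smooth. Then the gradient flow $\dot\theta_t=-\nabla_g F(p(\theta_t))$ of $F\circ p$ on $(\Theta,g)$ is given by $$\dot\theta_t=-G(\theta_t)^{-1}\nabla_\theta F(p(\theta_t)),$$ where $\nabla_\theta F(p(\theta))$ is the Euclidean gradient of $\theta\mapsto F(p(\theta))$. More explicitly, $$\dot\theta_t=-\Big(J_\theta p(\theta_t)^{\mathsf T}L(p(\theta_t))^{\dagger}J_\theta p(\theta_t)\Big)^{\dagger}J_\theta p(\theta_t)^{\mathsf T}\,\nabla_pF(p(\theta_t)),$$ where $\nabla_p F$ is the Euclidean gradient of $F$ with respect to $p$.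
   Context: $\mathcal{P}_+(I)=\{p\in\mathbb{R}^n:\sum_{i=1}^n p_i=1,\ p_i>0 \text{ for all } i\}$. Weighted graph: $G=(I,E,\omega)$ is a finite simple undirected graph with vertex set $I$, edge set $E$ and symmetric weights $\omega_{ij}=\omega_{ji}>0$ if $(i,j)\in E$, and $\omega_{ij}=0$ otherwise. (The symbol $G(\theta)$ with an argument denotes the matrix in the claim, not the graph.) Linear weighted Laplacian: for $a\in\mathbb{R}^n$, $L(a)=D^{\mathsf T}\Lambda(a)D\in\mathbb{R}^{n\times n}$, where, with each edge indexed once as $(i,j)$ with $i>j$, $D\in\mathbb{R}^{|E|\times n}$ has entries $D_{(i,j),k}=\sqrt{\omega_{ij}}$ if $k=i$, $-\sqrt{\omega_{ij}}$ if $k=j$, and $0$ otherwise; and $\Lambda(a)\in\mathbb{R}^{|E|\times|E|}$ is the diagonal matrix with entry $\frac{a_i+a_j}{2}$ at edge $(i,j)$. $A^{\dagger}$ denotes the Moore–Penrose pseudo-inverse of a matrix $A$. $J_\theta p(\theta)=\big(\partial p_i(\theta)/\partial\theta_j\big)_{1\le i\le n,\,1\le j\le d}$. The Riemannian gradient $\nabla_gF(p(\theta))\in T_\theta\Theta=\mathbb{R}^d$ is defined by $g_\theta(\nabla_gF(p(\theta)),a)=\nabla_\theta F(p(\theta))\cdot a=\sum_{i=1}^d\frac{\partial}{\partial\theta_i}F(p(\theta))\,a_i$ for all $a\in\mathbb{R}^d$. The Euclidean gradient $\nabla_pF=(\partial F/\partial p_j)_{j=1}^n$ is computed by regarding $F$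 as a smooth function on a neighbourhood of $\mathcal{P}_+(I)$ in $\mathbb{R}^n$ (any smooth extension). *)

(* Defs.v *)
From HB Require Import structures.
From mathcomp Require Import all_boot all_order all_algebra.
From mathcomp Require Import all_classical all_reals all_analysis.

Set Implicit Arguments.
Unset Strict Implicit.
Unset Printing Implicit Defensive.

Import Order.TTheory GRing.Theory Num.Theory.
Import numFieldNormedType.Exports.

Local Open Scope classical_set_scope.
Local Open Scope ring_scope.

(* Points of R^n and gradients are column vectors. *)

Definition open_simplex (R : realType) (n : nat) : set 'cV[R]_n :=
  [set q | \sum_(i < n) q i 0 = 1 /\ forall i, 0 < q i 0].

Record wgraph (R : realType) (n : nat) := WGraph {
  edge : rel 'I_n;
  weight : 'I_n -> 'I_n -> R;
  edge_sym : symmetric edge;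
  edge_irr : irreflexive edge;
  weight_sym : forall i j, weight i j = weight j i;
  weight_gt0 : forall i j, edge i j -> 0 < weight i j;
  weight_eq0 : forall i j, ~~ edge i j -> weight i j = 0
}.

Definition connected_wgraph (R : realType) (n : nat) (G : wgraph R n) : Prop :=
  forall i j : 'I_n, connect (edge G) i j.

(* Each undirected edge occurs once, as the pair (i, j) with i > j. *)
Definition edge_set (R : realType) (n : nat) (G : wgraph R n) :
    {set 'I_n * 'I_n} :=
  [set ij | edge G ij.1 ij.2 && (ij.2 < ij.1)%N]%SET.

Definition edge_at (R : realType) (n : nat) (G : wgraph R n)
    (k : 'I_#|edge_set G|) : 'I_n * 'I_n := enum_val k.

Definition incidence_mx (R : realType) (n : nat) (G : wgraph R n) :
    'M[R]_(#|edge_set G|, n) :=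
  \matrix_(k, l)
    let: (i, j) := edge_at k in
    if l == i then Num.sqrt (weight G i j)
    else if l == j then - Num.sqrt (weight G i j) else 0.

Definition edge_mean_mx (R : realType) (n : nat) (G : wgraph R n)
    (a : 'cV[R]_n) : 'M[R]_#|edge_set G| :=
  diag_mx (\row_k let: (i, j) := edge_at k in (a i 0 + a j 0) / 2).

Definition laplacian (R : realType) (n : nat) (G : wgraph R n)
    (a : 'cV[R]_n) : 'M[R]_n :=
  (incidence_mx G)^T *m edge_mean_mx G a *m incidence_mx G.

Definition is_mp_inverse (R : realType) (m n : nat)
    (A : 'M[R]_(m, n)) (X : 'M[R]_(n, m)) : Prop :=
  [/\ A *m X *m A = A, X *m A *m X = X,
      (A *m X)^T = A *m X & (X *m A)^T = X *m A].

(* MathComp's pinvmx is only some one-sided generalized inverse, so the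
   Moore-Penrose inverse is defined here. *)
Definition mp_inverse (R : realType) (m n : nat) (A : 'M[R]_(m, n)) :
    'M[R]_(n, m) := get (is_mp_inverse A).

Lemma mulmx_tr_eq0 (R : realType) (n : nat) (x : 'rV[R]_n) :
  x *m x^T = 0 -> x = 0.
Proof.
move=> /matrixP /(_ 0 0); rewrite !mxE => /eqP.
rewrite psumr_eq0 => [|j _]; last by rewrite mxE -expr2 sqr_ge0.
move=> /allP h; apply/rowP => j; rewrite mxE.
by have := h j (mem_index_enum j); rewrite mxE mulf_eq0 orbb => /eqP.
Qed.

Lemma gram_unitmx (R : realType) (r n : nat) (B : 'M[R]_(r, n)) :
  row_free B -> B *m B^T \in unitmx.
Proof.
move=> Bfree; rewrite -row_free_unit; apply: inj_row_free => x xBB.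
have : x *m B *m (x *m B)^T = 0 by rewrite trmx_mul !mulmxA -(mulmxA x) xBB mul0mx.
by move=> /mulmx_tr_eq0 /eqP; rewrite mulmx_free_eq0 // => /eqP.
Qed.

Lemma mp_inverseP (R : realType) (m n : nat) (A : 'M[R]_(m, n)) :
  is_mp_inverse A (mp_inverse A).
Proof.
suff [X hX] : exists X, is_mp_inverse A X by exact: (getI hX).
have : col_base A *m row_base A = A by exact: mulmx_base.
have := row_base_free A; have := col_base_full A.
move: (\rank A) (col_base A) (row_base A) => r C B Cfull Bfree AE.
have BB : B *m B^T \in unitmx by exact: gram_unitmx.
have CC : C^T *m C \in unitmx.
  by rewrite -[X in _ *m X]trmxK; apply: gram_unitmx; rewrite /row_free mxrank_tr.
have [P BP PBt] : exists2 P, B *m P = 1%:M & (P *m B)^T = P *m B.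
  exists (B^T *m invmx (B *m B^T)); first by rewrite mulmxA mulmxV.
  by rewrite !trmx_mul trmx_inv trmx_mul !trmxK mulmxA.
have [Q QC CQt] : exists2 Q, Q *m C = 1%:M & (C *m Q)^T = C *m Q.
  exists (invmx (C^T *m C) *m C^T); first by rewrite -mulmxA mulVmx.
  by rewrite !trmx_mul trmx_inv trmx_mul !trmxK mulmxA.
have AX : A *m (P *m Q) = C *m Q by rewrite -AE -mulmxA (mulmxA B) BP mul1mx.
have XA : P *m Q *m A = P *m B by rewrite -AE -!mulmxA (mulmxA Q) QC mul1mx.
exists (P *m Q); split.
- by rewrite AX -AE mulmxA -(mulmxA C) QC mulmx1.
- by rewrite XA mulmxA -(mulmxA P) BP mulmx1.
- by rewrite AX.
- by rewrite XA.
Qed.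

Lemma mp_inverse_uniq (R : realType) (m n : nat) (A : 'M[R]_(m, n))
    (X Y : 'M[R]_(n, m)) :
  is_mp_inverse A X -> is_mp_inverse A Y -> X = Y.
Proof.
move=> [X1 X2 X3 X4] [Y1 Y2 Y3 Y4].
have AXY : A *m X = A *m Y.
  rewrite -[LHS]X3 -{1}Y1 -(mulmxA (A *m Y)) trmx_mul X3 Y3.
  by rewrite mulmxA X1.
have XAY : X *m A = Y *m A.
  rewrite -[LHS]X4 -{1}Y1 -(mulmxA A) (mulmxA X A) trmx_mul X4 Y4.
  by rewrite -mulmxA (mulmxA A) X1.
by rewrite -X2 -mulmxA AXY mulmxA XAY Y2.
Qed.

(* This value is arbitrary where the partial derivative does not exist;
   continuously_differentiable therefore asks for derivability explicitly. *)
Definition partial (R : realType) (d : nat) (i : 'I_d)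
    (f : 'cV[R]_d -> R) : 'cV[R]_d -> R :=
  fun x => 'D_(delta_mx i 0) f x.

Definition euclidean_gradient (R : realType) (d : nat)
    (f : 'cV[R]_d -> R) (x : 'cV[R]_d) : 'cV[R]_d :=
  \col_i partial i f x.

Fixpoint continuously_differentiable (R : realType) (d k : nat)
    (U : set 'cV[R]_d) (f : 'cV[R]_d -> R) : Prop :=
  (forall x, U x -> {for x, continuous f}) /\
  if k is k'.+1 then
    forall i : 'I_d,
      (forall x, U x -> derivable f x (delta_mx i 0)) /\
      continuously_differentiable k' U (partial i f)
  else True.

Definition smooth (R : realType) (d : nat) (U : set 'cV[R]_d)
    (f : 'cV[R]_d -> R) : Prop :=
  forall k, continuously_differentiable k U f.

Definition smooth_map (R : realType) (d n : nat) (U : set 'cV[R]_d)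
    (p : 'cV[R]_d -> 'cV[R]_n) : Prop :=
  forall i : 'I_n, smooth U (fun x => p x i 0).

Definition jacobi_mx (R : realType) (d n : nat) (p : 'cV[R]_d -> 'cV[R]_n)
    (x : 'cV[R]_d) : 'M[R]_(n, d) :=
  \matrix_(i, j) partial j (fun y => p y i 0) x.

Definition smooth_extension (R : realType) (n : nat) (F : 'cV[R]_n -> R)
    (O : set 'cV[R]_n) (Fext : 'cV[R]_n -> R) : Prop :=
  [/\ open O, @open_simplex R n `<=` O, smooth O Fext &
      forall q, open_simplex q -> Fext q = F q].

(* The values of F outside the simplex play no role. *)
Definition smooth_on_simplex (R : realType) (n : nat) (F : 'cV[R]_n -> R) :
    Prop :=
  exists O Fext, smooth_extension F O Fext.

Definition riemannian_metric (R : realType) (d : nat) (U : set 'cV[R]_d)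
    (g : 'cV[R]_d -> 'cV[R]_d -> 'cV[R]_d -> R) : Prop :=
  [/\ forall x, U x -> forall (c : R) a a' b,
        g x (c *: a + a') b = c * g x a b + g x a' b,
      forall x, U x -> forall a b, g x a b = g x b a,
      forall x, U x -> forall a, a != 0 -> 0 < g x a a &
      forall a b, smooth U (fun x => g x a b)].

Definition is_riemannian_gradient (R : realType) (d : nat)
    (g : 'cV[R]_d -> 'cV[R]_d -> 'cV[R]_d -> R) (f : 'cV[R]_d -> R)
    (x v : 'cV[R]_d) : Prop :=
  forall a : 'cV[R]_d, g x v a = \sum_(i < d) partial i f x * a i 0.

Definition riemannian_gradient (R : realType) (d : nat)
    (g : 'cV[R]_d -> 'cV[R]_d -> 'cV[R]_d -> R) (f : 'cV[R]_d -> R)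
    (x : 'cV[R]_d) : 'cV[R]_d :=
  get (is_riemannian_gradient g f x).

Definition solves_ode (R : realType) (d : nat) (U : set 'cV[R]_d)
    (X : 'cV[R]_d -> 'cV[R]_d) (T : set R) (c : R -> 'cV[R]_d) : Prop :=
  forall t, T t -> U (c t) /\ is_derive t 1 c (X (c t)).

Definition is_gradient_flow (R : realType) (d : nat) (U : set 'cV[R]_d)
    (g : 'cV[R]_d -> 'cV[R]_d -> 'cV[R]_d -> R) (f : 'cV[R]_d -> R)
    (T : set R) (c : R -> 'cV[R]_d) : Prop :=
  solves_ode U (fun x => - riemannian_gradient g f x) T c.

Definition wasserstein_mx (R : realType) (n d : nat) (G : wgraph R n)
    (p : 'cV[R]_d -> 'cV[R]_n) (x : 'cV[R]_d) : 'M[R]_d :=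
  (jacobi_mx p x)^T *m mp_inverse (laplacian G (p x)) *m jacobi_mx p x.

Definition wasserstein_metric (R : realType) (n d : nat) (G : wgraph R n)
    (p : 'cV[R]_d -> 'cV[R]_n) (x a b : 'cV[R]_d) : R :=
  (a^T *m wasserstein_mx G p x *m b) 0 0.

(* Main.v *)
Require Import Defs.
From HB Require Import structures.
From mathcomp Require Import all_boot all_order all_algebra.
From mathcomp Require Import all_classical all_reals all_analysis.

Set Implicit Arguments.
Unset Strict Implicit.
Unset Printing Implicit Defensive.

Import Order.TTheory GRing.Theory Num.Theory.
Import numFieldNormedType.Exports.

Local Open Scope classical_set_scope.
Local Open Scope ring_scope.

(** Since the graph is connected and [p] is positive, the kernel of [L(p)] is
    the line of constant vectors. The columns of [J] sum to zero because [p]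
    takes values in the simplex, so the positive semidefinite matrix [L(p)^+]
    is definite on the range of the injective map [J]; hence the matrix of the
    metric is positive definite. It depends smoothly on the parameter because
    [L^+ = (L + P)^-1 - P], where [P] is the projection onto constant vectors.
    The gradient formulas then follow from the definition of the Riemannian
    gradient and the chain rule for a function with continuous partial
    derivatives. *)

Section Smooth.
Context {R : realType} {d : nat} {U : set 'cV[R]_d}.
Hypothesis Uopen : open U.
Implicit Types f g : 'cV[R]_d -> R.

Lemma near_open_eq f g x :
  (forall y, U y -> f y = g y) -> U x -> \forall y \near x, f y = g y.
Proof.
move=> fg Ux; have := open_nbhs_nbhs (conj Uopen Ux).
by apply: filterS => y /fg.
Qed.

Lemma eq_partial f g i x :
  (forall y, U y -> f y = g y) -> U x -> partial i f x = partial i g x.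
Proof. by move=> fg Ux; apply: near_eq_derive; exact: near_open_eq. Qed.

Lemma eq_continuous_at f g x :
  (forall y, U y -> f y = g y) -> U x ->
  {for x, continuous f} -> {for x, continuous g}.
Proof.
move=> fg Ux; rewrite /prop_for /continuous_at -(fg x Ux) => fC.
have fgx : {near x, f =1 g} by exact: near_open_eq.
exact: cvg_trans (near_eq_cvg fgx) fC.
Qed.

Lemma eq_continuously_differentiable k f g :
  (forall x, U x -> f x = g x) ->
  continuously_differentiable k U f -> continuously_differentiable k U g.
Proof.
elim: k f g => [|k IH] f g fg [fC fD]; split=> //;
  try by move=> x Ux; exact: eq_continuous_at (fC x Ux).
- move=> i; have [fDi fCi] := fD i; split.
    move=> x Ux; apply: near_eq_derivable (fDi x Ux); exact: near_open_eq fg Ux.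
  apply: IH fCi => x Ux; exact: eq_partial.
Qed.

Lemma continuously_differentiable_pred k f :
  continuously_differentiable k.+1 U f -> continuously_differentiable k U f.
Proof.
elim: k f => [|k IH] f [fC fD]; split => // i.
by have [? ?] := fD i; split=> //; apply: IH.
Qed.

Lemma continuously_differentiable_cst k (c : R) :
  continuously_differentiable k U (fun=> c).
Proof.
elim: k c => [|k IH] c; split=> //.
- by move=> x _; exact: cst_continuous.
- by move=> x _; exact: cst_continuous.
- move=> i; split=> [x _|]; first exact: derivable_cst.
  apply: eq_continuously_differentiable (IH 0) => x _.
  by rewrite /partial derive_cst.
Qed.

Lemma continuously_differentiableD k f g :
  continuously_differentiable k U f -> continuously_differentiable k U g ->
  continuously_differentiable k U (fun x => f x + g x).
Proof.
elim: k f g => [|k IH] f g [fC fD] [gC gD]; split=> //.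
- by move=> x Ux; apply: continuousD; [exact: fC|exact: gC].
- by move=> x Ux; apply: continuousD; [exact: fC|exact: gC].
- move=> i; have [fDi fCi] := fD i; have [gDi gCi] := gD i; split=> [x Ux|].
    by apply: derivableD; [exact: fDi|exact: gDi].
  apply: eq_continuously_differentiable (IH _ _ fCi gCi) => x Ux.
  by rewrite /partial deriveD //; [exact: fDi|exact: gDi].
Qed.

Lemma continuously_differentiableM k f g :
  continuously_differentiable k U f -> continuously_differentiable k U g ->
  continuously_differentiable k U (fun x => f x * g x).
Proof.
elim: k f g => [|k IH] f g fk gk; have [fC fD] := fk; have [gC gD] := gk.
  by split=> // x Ux; apply: continuousM; [exact: fC|exact: gC].
split=> [x Ux|i]; first by apply: continuousM; [exact: fC|exact: gC].
have [fDi fCi] := fD i; have [gDi gCi] := gD i; split=> [x Ux|].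
  by apply: derivableM; [exact: fDi|exact: gDi].
have f'g := IH _ _ (continuously_differentiable_pred fk) gCi.
have fg' := IH _ _ (continuously_differentiable_pred gk) fCi.
apply: eq_continuously_differentiable (continuously_differentiableD f'g fg').
by move=> x Ux; rewrite /partial deriveM //; [exact: fDi|exact: gDi].
Qed.

Lemma continuously_differentiableV k f :
  (forall x, U x -> f x != 0) -> continuously_differentiable k U f ->
  continuously_differentiable k U (fun x => (f x)^-1).
Proof.
move=> f0; elim: k => [|k IH] fk; have [fC fD] := fk.
  by split=> // x Ux; apply: continuousV; [exact: f0|exact: fC].
split=> [x Ux|i]; first by apply: continuousV; [exact: f0|exact: fC].
have [fDi fCi] := fD i; split=> [x Ux|].
  by apply: derivableV; [exact: f0|exact: fDi].
have fV := IH (continuously_differentiable_pred fk).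
have fVV := continuously_differentiableM fV fV.
have N1 := continuously_differentiable_cst k (-1).
apply: eq_continuously_differentiable
  (continuously_differentiableM N1 (continuously_differentiableM fVV fCi)).
move=> x Ux; rewrite /partial deriveV ?f0 //; last exact: fDi.
by rewrite mulN1r -invfM -expr2 scaleNr.
Qed.

Lemma eq_smooth f g : (forall x, U x -> f x = g x) -> smooth U f -> smooth U g.
Proof. by move=> fg fS k; exact: eq_continuously_differentiable (fS k). Qed.

Lemma smooth_partial i f : smooth U f -> smooth U (partial i f).
Proof. by move=> fS k; have [_ /(_ i)[]] := fS k.+1. Qed.

Lemma smooth_cst (c : R) : smooth U (fun=> c).
Proof. by move=> k; exact: continuously_differentiable_cst. Qed.

Lemma smoothD f g : smooth U f -> smooth U g -> smooth U (fun x => f x + g x).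
Proof. by move=> fS gS k; exact: continuously_differentiableD. Qed.

Lemma smoothM f g : smooth U f -> smooth U g -> smooth U (fun x => f x * g x).
Proof. by move=> fS gS k; exact: continuously_differentiableM. Qed.

Lemma smoothV f : (forall x, U x -> f x != 0) -> smooth U f ->
  smooth U (fun x => (f x)^-1).
Proof. by move=> f0 fS k; exact: continuously_differentiableV. Qed.

Lemma smooth_sum (I : Type) (r : seq I) (f : I -> 'cV[R]_d -> R) :
  (forall i, smooth U (f i)) -> smooth U (fun x => \sum_(i <- r) f i x).
Proof.
move=> fS; elim: r => [|i r IH].
  by apply: eq_smooth (smooth_cst 0) => x _; rewrite big_nil.
by apply: eq_smooth (smoothD (fS i) IH) => x _; rewrite big_cons.
Qed.

Lemma smooth_prod (I : Type) (r : seq I) (f : I -> 'cV[R]_d -> R) :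
  (forall i, smooth U (f i)) -> smooth U (fun x => \prod_(i <- r) f i x).
Proof.
move=> fS; elim: r => [|i r IH].
  by apply: eq_smooth (smooth_cst 1) => x _; rewrite big_nil.
by apply: eq_smooth (smoothM (fS i) IH) => x _; rewrite big_cons.
Qed.

Definition smooth_mx m n (A : 'cV[R]_d -> 'M[R]_(m, n)) :=
  forall i j, smooth U (fun x => A x i j).

Lemma eq_smooth_mx m n (A B : 'cV[R]_d -> 'M[R]_(m, n)) :
  (forall x, U x -> A x = B x) -> smooth_mx A -> smooth_mx B.
Proof.
by move=> AB AS i j; apply: eq_smooth (AS i j) => x /AB ->.
Qed.

Lemma smooth_mx_cst m n (A : 'M[R]_(m, n)) : smooth_mx (fun=> A).
Proof. by move=> i j; exact: smooth_cst. Qed.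

Lemma smooth_mxD m n (A B : 'cV[R]_d -> 'M[R]_(m, n)) :
  smooth_mx A -> smooth_mx B -> smooth_mx (fun x => A x + B x).
Proof.
move=> AS BS i j; apply: eq_smooth (smoothD (AS i j) (BS i j)) => x _.
by rewrite mxE.
Qed.

Lemma smooth_mx_tr m n (A : 'cV[R]_d -> 'M[R]_(m, n)) :
  smooth_mx A -> smooth_mx (fun x => (A x)^T).
Proof. by move=> AS i j; apply: eq_smooth (AS j i) => x _; rewrite mxE. Qed.

Lemma smooth_mulmx m n q (A : 'cV[R]_d -> 'M[R]_(m, n))
    (B : 'cV[R]_d -> 'M[R]_(n, q)) :
  smooth_mx A -> smooth_mx B -> smooth_mx (fun x => A x *m B x).
Proof.
move=> AS BS i j.
have ABS k : smooth U (fun x => A x i k * B x k j) by apply: smoothM.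
by apply: eq_smooth (smooth_sum (index_enum _) ABS) => x _; rewrite mxE.
Qed.

Lemma smooth_det n (A : 'cV[R]_d -> 'M[R]_n) :
  smooth_mx A -> smooth U (fun x => \det (A x)).
Proof.
move=> AS; apply: smooth_sum => s; apply: smoothM; first exact: smooth_cst.
by apply: smooth_prod => i; exact: AS.
Qed.

Lemma smooth_invmx n (A : 'cV[R]_d -> 'M[R]_n) :
  (forall x, U x -> A x \in unitmx) -> smooth_mx A ->
  smooth_mx (fun x => invmx (A x)).
Proof.
move=> Aunit AS i j.
have detV : smooth U (fun x => (\det (A x))^-1).
  apply: smoothV (smooth_det AS) => x /Aunit.
  by rewrite unitmxE unitfE.
have adjS : smooth U (fun x => cofactor (A x) j i).
  apply: smoothM; first exact: smooth_cst.
  apply: smooth_det => k l.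
  by apply: eq_smooth (AS (lift j k) (lift i l)) => x _; rewrite !mxE.
apply: eq_smooth (smoothM detV adjS) => x Ux.
by rewrite /invmx Aunit // !mxE.
Qed.

End Smooth.

Lemma is_diff_bound {R : numFieldType} {V W : normedModType R} (f : V -> W)
    (df : {linear V -> W}) (x : V) :
  continuous df ->
  (forall e : R, 0 < e ->
     \forall h \near 0, `|f (h + x) - f x - df h| <= e * `|h|) ->
  is_diff x f df.
Proof.
move=> dfC fB; have dfo : f \o shift x = cst (f x) + df +o_ 0 id.
  apply/eqaddoP => e /fB; apply: filterS => h.
  by rewrite -addrA -opprD.
have dE : 'd f x = df :> (V -> W) by exact: diff_unique dfC dfo.
by split=> //; apply/diff_locallyP; rewrite dE.
Qed.

Lemma is_derive_line {R : realType} {V W : normedModType R} (f : V -> W)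
    (x v : V) (t : R) :
  derivable f (t *: v + x) v ->
  is_derive t 1 (fun s => f (s *: v + x)) ('D_v f (t *: v + x)).
Proof.
have E : (fun h : R => h^-1 *: (f (h *: v + (t *: v + x)) - f (t *: v + x))) =
         (fun h : R => h^-1 *: (f ((h%:A + t) *: v + x) - f (t *: v + x))).
  by apply/funext => h; rewrite [h%:A]mulr1 scalerDl addrA.
by move=> fD; split; rewrite /derivable /derive /= -E.
Qed.

Section ContinuousPartials.
Context {R : realType} {n : nat}.
Implicit Types (f : 'cV[R]_n -> R) (x h : 'cV[R]_n).

Lemma partial_mvt f x (i : 'I_n) (s : R) :
  (forall t : R, `|t| <= `|s| ->
     derivable f (t *: delta_mx i 0 + x) (delta_mx i 0)) ->
  exists2 t : R, `|t| <= `|s| &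
    f (s *: delta_mx i 0 + x) - f x = partial i f (t *: delta_mx i 0 + x) * s.
Proof.
move=> fD; set phi := fun t : R => f (t *: delta_mx i 0 + x).
set dphi := fun t : R => partial i f (t *: delta_mx i 0 + x).
have phiD (t : R) : `|t| <= `|s| ->
    is_derive t (1 : R) phi (partial i f (t *: delta_mx i 0 + x)).
  by move=> /fD; exact: is_derive_line.
have phi0 : phi 0 = f x by rewrite /phi scale0r add0r.
have phiC (a b : R) : (forall t, t \in `[a, b]%R -> `|t| <= `|s|) ->
    {within `[a, b], continuous phi}.
  move=> ab; apply: derivable_within_continuous => t /ab /phiD tD.
  exact: ex_derive.
have [s0|s0] := leP 0 s.
  have cs (t : R) : t \in `[0, s]%R -> `|t| <= `|s|.
    by rewrite in_itv/= => /andP[t0 ts]; rewrite !ger0_norm.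
  have [t|t tI E] := @MVT_segment _ _ dphi _ _ s0 _ (phiC _ _ cs).
    by move=> /subset_itv_oo_cc /cs; exact: phiD.
  by exists t; [exact: cs | rewrite -phi0 E subr0].
have cs (t : R) : t \in `[s, 0]%R -> `|t| <= `|s|.
  by rewrite in_itv/= => /andP[st t0]; rewrite !ler0_norm ?(ltW s0) // lerN2.
have [t|t tI E] := @MVT_segment _ _ dphi _ _ (ltW s0) _ (phiC _ _ cs).
  by move=> /subset_itv_oo_cc /cs; exact: phiD.
exists t; first exact: cs.
by rewrite -phi0 -opprB E sub0r mulrN opprK.
Qed.

Lemma norm_col_le x (c : R) : 0 <= c ->
  (forall i, `|x i 0| <= c) -> `|x| <= c.
Proof.
move=> c0 xc; rewrite /Num.Def.normr/= mx_normrE.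
apply: bigmax_le => //= -[i j] _.
by rewrite (ord1 j).
Qed.

Lemma coord_norm_le x i : `|x i 0| <= `|x|.
Proof.
rewrite [leRHS]/Num.Def.normr/= mx_normrE.
exact: (le_bigmax _ (fun ij : 'I_n * 'I_1 => `|x ij.1 ij.2|) (i, 0)).
Qed.

(* Moves from [q] to [h + q] one coordinate at a time, applying the mean value
   theorem to each step. *)
Lemma coordinatewise_mvt f (q h : 'cV[R]_n) :
  (forall x i, `|x - q| <= `|h| -> derivable f x (delta_mx i 0)) ->
  exists2 xi : 'I_n -> 'cV[R]_n, forall i, `|xi i - q| <= `|h| &
    f (h + q) - f q = \sum_i partial i f (xi i) * h i 0.
Proof.
move=> fD; pose s k : 'cV[R]_n := \col_i (if (i < k)%N then h i 0 else 0).
have sS (k : 'I_n) : s k.+1 = h k 0 *: delta_mx k 0 + s k.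
  apply/colP => i; rewrite !mxE eqxx andbT.
  have [->|ik] := eqVneq i k; first by rewrite ltnSn ltnn mulr1 addr0.
  by rewrite mulr0 add0r ltnS leq_eqVlt (inj_eq val_inj) (negbTE ik).
have step (k : 'I_n) : exists2 z, `|z - q| <= `|h| &
    f (s k.+1 + q) - f (s k + q) = partial k f z * h k 0.
  have near_q (t : R) : `|t| <= `|h k 0| ->
      `|t *: delta_mx k 0 + (s k + q) - q| <= `|h|.
    move=> th; rewrite addrA addrK; apply: norm_col_le => // i.
    rewrite !mxE eqxx andbT; have [->|ik] := eqVneq i k.
      by rewrite ltnn mulr1 addr0 (le_trans th) // coord_norm_le.
    by rewrite mulr0 add0r; case: ifP => _; rewrite ?normr0 // coord_norm_le.
  have [t th E] := @partial_mvt f (s k + q) k (h k 0)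
    (fun t th => fD _ _ (near_q t th)).
  exists (t *: delta_mx k 0 + (s k + q)); first exact: near_q.
  by rewrite -E addrA -sS.
have {}step (k : 'I_n) : exists z, `|z - q| <= `|h| /\
    f (s k.+1 + q) - f (s k + q) = partial k f z * h k 0.
  by have [z] := step k; exists z.
have [xi xiP] := choice step.
exists xi => [i|]; first by have [] := xiP i.
under eq_bigr do rewrite -(xiP _).2.
rewrite -(big_mkord xpredT (fun k => f (s k.+1 + q) - f (s k + q))).
rewrite telescope_sumr //; congr (f _ - f _); apply/colP => i.
  by rewrite !mxE ltn_ord.
by rewrite !mxE ltn0 add0r.
Qed.

Lemma is_diff_continuous_partials (O : set 'cV[R]_n) f q :
  open O -> O q ->
  (forall x i, O x -> derivable f x (delta_mx i 0)) ->
  (forall i, {for q, continuous (partial i f)}) ->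
  is_diff q f (fun h => \sum_i partial i f q * h i 0).
Proof.
move=> Oopen Oq fD fC; pose df (h : 'cV[R]_n) := \sum_i partial i f q * h i 0.
have df_linear : linear df.
  move=> c x y; rewrite /df scaler_sumr -big_split /=; apply: eq_bigr => i _.
  by rewrite !mxE mulrDr mulrCA.
pose dfL : {linear 'cV[R]_n -> R} :=
  HB.pack df (GRing.isLinear.Build _ _ _ _ _ df_linear).
have dfC : continuous dfL.
  have addC : continuous (fun z : R * R => z.1 + z.2) by exact: add_continuous.
  apply: (continuous_big addC) => i _ x.
  apply: (@continuousM R _ (cst (partial i f q)) (fun h : 'cV[R]_n => h i 0)).
    exact: cst_continuous.
  exact: coord_continuous.
apply: (is_diff_bound (df := dfL)) => // e e0.
  have e'0 : 0 < e / n.+1%:R by rewrite divr_gt0.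
  have : \forall x \near q, O x /\ forall i,
      `|partial i f q - partial i f x| <= e / n.+1%:R.
    apply: filterI; first exact: open_nbhs_nbhs.
    apply: (@filter_forall _ _
      (fun i x => `|partial i f q - partial i f x| <= e / n.+1%:R) (nbhs q)).
    move=> i.
    by move/cvgrPdist_le : (fC i) => /(_ _ e'0).
  move=> /nbhs_ballP[r /= r0 rP].
  near=> h.
  have hr : `|h| < r.
    near: h; apply/nbhs_ballP; exists r => // z.
    by rewrite -ball_normE /= sub0r normrN.
  have inball x : `|x - q| <= `|h| -> ball q r x.
    by rewrite -ball_normE /= distrC => xh; exact: le_lt_trans xh hr.
  have [x i /inball /rP[Ox _]|xi xih E] := @coordinatewise_mvt f q h.
    exact: fD.
  have -> : f (h + q) - f q - df h =
      \sum_i (partial i f (xi i) - partial i f q) * h i 0.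
    by rewrite E /df -sumrB; apply: eq_bigr => i _; rewrite mulrBl.
  apply: (le_trans (ler_norm_sum _ _ _)).
  apply: (@le_trans _ _ (\sum_(i < n) e / n.+1%:R * `|h|)).
    apply: ler_sum => i _; rewrite normrM distrC; apply: ler_pM => //.
      by have /inball /rP[_ ] := xih i.
    exact: coord_norm_le.
  rewrite sumr_const card_ord -[leLHS]mulr_natr mulrAC; apply: ler_wpM2r => //.
  rewrite -mulrA ler_piMr ?(ltW e0) // mulrC ler_pdivrMr // mul1r ler_nat.
  exact: leqnSn.
Unshelve. all: by end_near. Qed.

End ContinuousPartials.

Lemma partial_comp (R : realType) (d n : nat) (O : set 'cV[R]_n)
    (f : 'cV[R]_n -> R) (p : 'cV[R]_d -> 'cV[R]_n) (x : 'cV[R]_d) (j : 'I_d) :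
  open O -> O (p x) -> smooth O f ->
  (forall i, derivable (fun y => p y i 0) x (delta_mx j 0)) ->
  partial j (f \o p) x =
  \sum_i partial i f (p x) * partial j (fun y => p y i 0) x.
Proof.
move=> Oopen Opx fS pD.
have pD' : derivable p x (delta_mx j 0).
  by apply/derivable_mxP => i k; rewrite (ord1 k).
have [_ fD] := fS 1%N.
have fC i : {for p x, continuous (partial i f)}.
  by have [_ [+ _]] := fD i; exact.
have fdiff := is_diff_continuous_partials Oopen Opx
  (fun y i Oy => (fD i).1 y Oy) fC.
pose gam (s : R) := p (s *: delta_mx j 0 + x).
have gam0 : gam 0 = p x by rewrite /gam scale0r add0r.
have gamD : is_derive (0 : R) 1 gam ('D_(delta_mx j 0) p x).
  have := @is_derive_line _ _ _ p x (delta_mx j 0) 0.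
  by rewrite scale0r add0r; apply.
have gdiff : differentiable gam 0 by apply/derivable1_diffP.
have fgdiff : differentiable f (gam 0) by rewrite gam0.
have -> : partial j (f \o p) x = 'D_1 (f \o gam) 0.
  rewrite /partial; apply/esym/derive_val.
  have := @is_derive_line _ _ _ (f \o p) x (delta_mx j 0) 0.
  rewrite scale0r add0r; apply; apply/derivable1P/derivable1_diffP.
  exact: (@differentiable_comp _ _ _ _ gam f).
rewrite deriveE; last exact: (@differentiable_comp _ _ _ _ gam f).
rewrite diff_comp //= -(deriveE _ gdiff) (@derive_val _ _ _ _ _ _ _ gamD) gam0.
rewrite (@diff_val _ _ _ _ _ _ _ fdiff); apply: eq_bigr => i _.
by rewrite derive_mx // mxE.
Qed.

Section MoorePenrose.
Context {R : realType} {n : nat}.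
Implicit Types A P : 'M[R]_n.

Lemma mp_inverse_unitmx A : A \in unitmx -> mp_inverse A = invmx A.
Proof.
move=> Au; apply: mp_inverse_uniq (mp_inverseP A) _.
by split; rewrite ?mulmxV ?mulVmx ?mul1mx ?trmx1.
Qed.

Lemma trmx_mp_inverse A : (mp_inverse A)^T = mp_inverse A^T.
Proof.
apply: mp_inverse_uniq (mp_inverseP A^T).
have [h1 h2 h3 h4] := mp_inverseP A; set X := mp_inverse A in h1 h2 h3 h4 *.
split; rewrite -?trmx_mul ?mulmxA ?h1 ?h2 ?h3 ?h4 //.
Qed.

Lemma kermx_mp_inverse A (x : 'cV[R]_n) :
  A^T = A -> mp_inverse A *m x = 0 -> A *m x = 0.
Proof.
move=> At Xx; have [h1 h2 h3 h4] := mp_inverseP A.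
have Xt : (mp_inverse A)^T = mp_inverse A by rewrite trmx_mp_inverse At.
have comm : A *m mp_inverse A = mp_inverse A *m A by rewrite -h3 trmx_mul At Xt.
by rewrite -h1 -(mulmxA A) -comm -!mulmxA Xx !mulmx0.
Qed.

Lemma tr_mul_self_ge0 m (x : 'cV[R]_m) : 0 <= (x^T *m x) 0 0.
Proof. by rewrite mxE sumr_ge0 // => i _; rewrite mxE -expr2 sqr_ge0. Qed.

Lemma tr_mul_self_eq0 m (x : 'cV[R]_m) : (x^T *m x) 0 0 = 0 -> x = 0.
Proof.
move=> xx; apply: trmx_inj; rewrite trmx0; apply: mulmx_tr_eq0.
by apply/matrixP => i j; rewrite trmxK !ord1 xx mxE.
Qed.

Lemma mp_inverse_gram_form m (B : 'M[R]_(m, n)) (x : 'cV[R]_n) :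
  let X := mp_inverse (B^T *m B) in
  x^T *m X *m x = (B *m (X *m x))^T *m (B *m (X *m x)).
Proof.
move=> X; have [_ h2 _ _] : is_mp_inverse (B^T *m B) X.
  exact: mp_inverseP.
have Xt : X^T = X by rewrite trmx_mp_inverse trmx_mul trmxK.
by rewrite -{1}h2 !trmx_mul Xt !mulmxA.
Qed.

Lemma mp_inverse_gram_form_ge0 m (B : 'M[R]_(m, n)) (x : 'cV[R]_n) :
  0 <= (x^T *m mp_inverse (B^T *m B) *m x) 0 0.
Proof. by rewrite mp_inverse_gram_form tr_mul_self_ge0. Qed.

Lemma mp_inverse_gram_form_eq0 m (B : 'M[R]_(m, n)) (x : 'cV[R]_n) :
  (x^T *m mp_inverse (B^T *m B) *m x) 0 0 = 0 -> B *m x = 0.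
Proof.
rewrite mp_inverse_gram_form => /tr_mul_self_eq0 BXx.
apply: tr_mul_self_eq0; rewrite trmx_mul -mulmxA (mulmxA B^T).
rewrite (@kermx_mp_inverse (B^T *m B)) ?mulmx0 ?mxE ?trmx_mul ?trmxK //.
have [_ h2 _ _] := mp_inverseP (B^T *m B).
by rewrite -h2 -!mulmxA BXx !mulmx0.
Qed.

Lemma unitmx_add_kernel_projection A P :
  P *m A = 0 -> P *m P = P -> (forall x : 'cV[R]_n, A *m x = 0 -> P *m x = x) ->
  A + P \in unitmx.
Proof.
move=> PA PP kerA; rewrite -unitmx_tr -row_free_unit.
apply: inj_row_free => v vM; suff : v^T = 0.
  by move=> /(congr1 trmx); rewrite trmxK trmx0.
have : (A + P) *m v^T = 0 by rewrite -[A + P]trmxK -trmx_mul vM trmx0.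
move: v^T => x Mx.
have Px : P *m x = 0.
  have E : P *m (A + P) = P by rewrite mulmxDr PA add0r PP.
  by rewrite -E -mulmxA Mx mulmx0.
have Ax : A *m x = 0 by move: Mx; rewrite mulmxDl Px addr0.
by rewrite -(kerA _ Ax) Px.
Qed.

(* If [P] is the orthogonal projection onto the kernel of [A], then [A + P] is
   invertible and inverts [A] on the range of [A]; unlike [mp_inverse], this
   expression visibly depends smoothly on [A]. *)
Lemma mp_inverse_kernel_projection A P :
  A *m P = 0 -> P *m A = 0 -> P *m P = P -> P^T = P ->
  (forall x : 'cV[R]_n, A *m x = 0 -> P *m x = x) ->
  mp_inverse A = invmx (A + P) - P.
Proof.
move=> AP PA PP Pt kerA; have Mu := unitmx_add_kernel_projection PA PP kerA.
set M := A + P in Mu *.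
have PV : P *m invmx M = P.
  have PM : P *m M = P by rewrite mulmxDr PA add0r PP.
  by rewrite -{1}PM mulmxK.
have VP : invmx M *m P = P.
  have MP : M *m P = P by rewrite mulmxDl AP add0r PP.
  by rewrite -{1}MP mulKmx.
have AE : A = M - P by rewrite addrK.
have AX : A *m (invmx M - P) = 1%:M - P.
  by rewrite mulmxBr AP subr0 AE mulmxBl mulmxV // PV.
have XA : (invmx M - P) *m A = 1%:M - P.
  by rewrite mulmxBl PA subr0 AE mulmxBr mulVmx // VP.
apply: mp_inverse_uniq (mp_inverseP A) _; split.
- by rewrite AX mulmxBl mul1mx PA subr0.
- by rewrite XA mulmxBl mul1mx mulmxBr PV PP subrr subr0.
- by rewrite AX linearB /= trmx1 Pt.
- by rewrite XA linearB /= trmx1 Pt.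
Qed.

End MoorePenrose.

Section Laplacian.
Context {R : realType} {n : nat} (G : wgraph R n).
Implicit Types (q x : 'cV[R]_n).

Definition scaled_incidence_mx q : 'M[R]_(#|edge_set G|, n) :=
  diag_mx (\row_k Num.sqrt (edge_mean_mx G q k k)) *m incidence_mx G.

Lemma laplacian_gram q : (forall i, 0 < q i 0) ->
  laplacian G q = (scaled_incidence_mx q)^T *m scaled_incidence_mx q.
Proof.
move=> q0; rewrite /scaled_incidence_mx trmx_mul tr_diag_mx !mulmxA.
rewrite -(mulmxA _ (diag_mx _) (diag_mx _)) mulmx_diag.
congr (_ *m diag_mx _ *m _).
apply/rowP => k; rewrite !mxE eqxx mulr1n; case: (edge_at k) => i j.
by rewrite -expr2 sqr_sqrtr // divr_ge0 // addr_ge0 // ltW.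
Qed.

Lemma mul_incidence_mx (x : 'cV[R]_n) k :
  (incidence_mx G *m x) k 0 =
  Num.sqrt (weight G (edge_at k).1 (edge_at k).2) *
    (x (edge_at k).1 0 - x (edge_at k).2 0).
Proof.
have := enum_valP k; rewrite -/(edge_at k) inE mxE.
under eq_bigr do rewrite mxE.
case: (edge_at k) => i j /= /andP[_ ji].
have ji' : j != i by rewrite -(inj_eq val_inj) neq_ltn ji.
rewrite (bigD1 i) // (bigD1 j) //= eqxx (negbTE ji') eqxx.
rewrite big1 ?addr0 => [|l /andP[/negbTE -> /negbTE ->]]; last by rewrite mul0r.
by rewrite mulNr mulrBr.
Qed.

Lemma scaled_incidence_ker_const q x :
  connected_wgraph G -> (forall i, 0 < q i 0) ->
  scaled_incidence_mx q *m x = 0 -> forall i j, x i 0 = x j 0.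
Proof.
move=> Gconn q0 Bx.
have edge_const i j : edge G i j -> (j < i)%N -> x i 0 = x j 0.
  move=> ij ji; have ijE : (i, j) \in edge_set G by rewrite inE /= ij.
  have := congr1 (fun A : 'cV_ _ => A (enum_rank_in ijE (i, j)) 0) Bx.
  rewrite /= -mulmxA mul_diag_mx mxE [X in X * _]mxE mul_incidence_mx !mxE.
  rewrite eqxx mulr1n /edge_at enum_rankK_in //= => /eqP.
  rewrite !mulf_eq0 !sqrtr_eq0 subr_eq0 !leNgt weight_gt0 //=.
  by rewrite divr_gt0 ?addr_gt0 //= => /eqP.
have edge_const' i j : edge G i j -> x i 0 = x j 0.
  move=> ij; have [ltij|ltji|/val_inj -> //] := ltngtP i j; last first.
    exact: edge_const.
  by rewrite (@edge_const j i) // edge_sym.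
move=> i j; have /connectP[s] := Gconn i j.
elim: s i => [|k s IH] i /=; first by move=> _ ->.
by move=> /andP[/edge_const' -> sP] jE; exact: IH.
Qed.

Definition mean_mx : 'M[R]_n := const_mx n%:R^-1.

Lemma mean_mx_const x : (forall i j, x i 0 = x j 0) -> mean_mx *m x = x.
Proof.
move=> xc; apply/colP => i; rewrite mxE.
under eq_bigr do rewrite mxE (xc _ i).
rewrite sumr_const card_ord -mulrnAl -mulr_natr mulVf ?mul1r //.
by rewrite pnatr_eq0 -lt0n (leq_ltn_trans (leq0n i)).
Qed.

Lemma mean_mx_idem : mean_mx *m mean_mx = mean_mx.
Proof.
apply/matrixP => i j.
rewrite -[RHS](_ : col j mean_mx i 0 = _); last by rewrite mxE.
rewrite -(@mean_mx_const (col j mean_mx)) => [|k l]; last by rewrite !mxE.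
by rewrite !mxE; apply: eq_bigr => k _; rewrite !mxE.
Qed.

Lemma mean_mx_tr : mean_mx^T = mean_mx.
Proof. exact: trmx_const. Qed.

Lemma laplacian_mean_mx q : laplacian G q *m mean_mx = 0.
Proof.
rewrite /laplacian -mulmxA (_ : incidence_mx G *m mean_mx = 0) ?mulmx0 //.
apply/matrixP => k l.
transitivity ((incidence_mx G *m col l mean_mx) k 0).
  by rewrite !mxE; apply: eq_bigr => i _; rewrite !mxE.
by rewrite mul_incidence_mx !mxE subrr mulr0.
Qed.

Lemma trmx_laplacian q : (laplacian G q)^T = laplacian G q.
Proof. by rewrite /laplacian !trmx_mul trmxK tr_diag_mx mulmxA. Qed.

Lemma mean_mx_laplacian q : mean_mx *m laplacian G q = 0.
Proof.
apply: trmx_inj.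
by rewrite trmx_mul trmx_laplacian mean_mx_tr laplacian_mean_mx trmx0.
Qed.

Lemma laplacian_eq0_mean q x : connected_wgraph G -> (forall i, 0 < q i 0) ->
  laplacian G q *m x = 0 -> mean_mx *m x = x.
Proof.
move=> Gconn q0 Lx; apply/mean_mx_const/(scaled_incidence_ker_const Gconn q0).
apply: tr_mul_self_eq0; rewrite trmx_mul -mulmxA (mulmxA _ _ x).
by rewrite -laplacian_gram // Lx mulmx0 mxE.
Qed.

End Laplacian.

Lemma sum_mul_delta (R : pzSemiRingType) (d : nat) (u : 'cV[R]_d) (k : 'I_d) :
  \sum_i u i 0 * (delta_mx k 0 : 'cV[R]_d) i 0 = u k 0.
Proof.
rewrite (bigD1 k) //= mxE !eqxx mulr1 big1 ?addr0 // => i ik.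
by rewrite mxE (negbTE ik) mulr0.
Qed.

Section WassersteinMetric.
Context {R : realType} {n d : nat} (G : wgraph R n) {Theta : set 'cV[R]_d}.
Context {p : 'cV[R]_d -> 'cV[R]_n}.
Hypothesis Gconn : connected_wgraph G.
Hypothesis Theta_open : open Theta.
Hypothesis p_simplex : forall th, Theta th -> open_simplex (p th).
Hypothesis p_smooth : smooth_map Theta p.
Hypothesis J_rank : forall th, Theta th -> \rank (jacobi_mx p th) = d.

Lemma derivable_smooth_map th i j : Theta th ->
  derivable (fun y => p y i 0) th (delta_mx j 0).
Proof. by move=> thT; have [_ /(_ j)[+ _]] := p_smooth i 1%N; apply. Qed.

(* The coordinates of [p] sum to [1], so the columns of the Jacobian are
   tangent to the simplex. *)
Lemma mean_mx_jacobi th : Theta th -> mean_mx *m jacobi_mx p th = 0.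
Proof.
move=> thT; apply/matrixP => i j; rewrite !mxE.
under eq_bigr do rewrite !mxE.
rewrite -mulr_sumr -[X in _ * X = _]derive_sum; last first.
  by move=> k; exact: derivable_smooth_map.
rewrite (_ : 'D__ _ _ = 0) ?mulr0 //.
rewrite -(derive_cst (1 : R) th (delta_mx j 0)).
apply: (eq_partial (U := Theta)) => // y /p_simplex[<- _].
by rewrite fct_sumE.
Qed.

Lemma jacobi_inj th (x : 'cV[R]_d) :
  Theta th -> jacobi_mx p th *m x = 0 -> x = 0.
Proof.
move=> thT Jx; apply: trmx_inj; rewrite trmx0; apply/eqP.
rewrite -(@mulmx_free_eq0 _ _ _ _ _ (jacobi_mx p th)^T).
  by rewrite -trmx_mul Jx trmx0.
by rewrite /row_free mxrank_tr J_rank.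
Qed.

Lemma simplex_gt0 th i : Theta th -> 0 < p th i 0.
Proof. by move=> /p_simplex[_ ]; apply. Qed.

Lemma wasserstein_metricE th a b :
  wasserstein_metric G p th a b =
  ((jacobi_mx p th *m a)^T *m mp_inverse (laplacian G (p th)) *m
    (jacobi_mx p th *m b)) 0 0.
Proof. by rewrite /wasserstein_metric /wasserstein_mx trmx_mul !mulmxA. Qed.

Lemma trmx_wasserstein_mx th :
  (wasserstein_mx G p th)^T = wasserstein_mx G p th.
Proof.
rewrite /wasserstein_mx !trmx_mul trmxK trmx_mp_inverse trmx_laplacian.
exact: mulmxA.
Qed.

Lemma wasserstein_metric_gt0 th a :
  Theta th -> a != 0 -> 0 < wasserstein_metric G p th a a.
Proof.
move=> thT; have p0 i := simplex_gt0 i thT.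
rewrite wasserstein_metricE laplacian_gram // lt_def.
rewrite mp_inverse_gram_form_ge0 andbT.
apply: contra_neq => /mp_inverse_gram_form_eq0 BJa.
apply: (@jacobi_inj th) => //.
rewrite -(mean_mx_const (scaled_incidence_ker_const Gconn p0 BJa)).
by rewrite mulmxA mean_mx_jacobi // mul0mx.
Qed.

Lemma wasserstein_unitmx th : Theta th -> wasserstein_mx G p th \in unitmx.
Proof.
move=> thT; rewrite -row_free_unit; apply: inj_row_free => v vW.
apply: trmx_inj; apply/eqP; rewrite trmx0; apply/negPn/negP.
move=> /(wasserstein_metric_gt0 thT).
by rewrite /wasserstein_metric trmxK vW mul0mx mxE ltxx.
Qed.

Lemma smooth_laplacian : smooth_mx (U := Theta) (fun th => laplacian G (p th)).
Proof.
apply: smooth_mulmx => //; last exact: smooth_mx_cst.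
apply: smooth_mulmx => //; first exact: smooth_mx_cst.
move=> k l; have [->|kl] := eqVneq k l; last first.
  apply: (eq_smooth Theta_open) (smooth_cst Theta_open 0) => x _.
  by rewrite !mxE (negbTE kl).
have half := smooth_cst Theta_open (2^-1 : R).
have sumS := smoothD Theta_open
  (p_smooth (edge_at l).1) (p_smooth (edge_at l).2).
apply: (eq_smooth Theta_open) (smoothM Theta_open sumS half) => x _.
by rewrite !mxE eqxx mulr1n; case: (edge_at l).
Qed.

Lemma smooth_jacobi : smooth_mx (U := Theta) (jacobi_mx p).
Proof.
move=> i j.
apply: (eq_smooth Theta_open) (smooth_partial j (p_smooth i)) => x _.
by rewrite mxE.
Qed.

Lemma smooth_mp_inverse_laplacian :
  smooth_mx (U := Theta) (fun th => mp_inverse (laplacian G (p th))).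
Proof.
have kerL th : Theta th -> forall x : 'cV_n,
    laplacian G (p th) *m x = 0 -> mean_mx *m x = x.
  by move=> thT x; apply: laplacian_eq0_mean => // i; exact: simplex_gt0.
pose X th := invmx (laplacian G (p th) + mean_mx) - mean_mx : 'M[R]_n.
apply: (eq_smooth_mx Theta_open (A := X)) => [th thT|].
  rewrite /X -(@mp_inverse_kernel_projection _ _ _ mean_mx) //.
  - exact: laplacian_mean_mx.
  - exact: mean_mx_laplacian.
  - exact: mean_mx_idem.
  - exact: mean_mx_tr.
  - exact: kerL.
apply: smooth_mxD => //; last exact: smooth_mx_cst.
apply: smooth_invmx => //; last first.
  by apply: smooth_mxD => //; [exact: smooth_laplacian|exact: smooth_mx_cst].
move=> th thT; apply: unitmx_add_kernel_projection.
- exact: mean_mx_laplacian.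
- exact: mean_mx_idem.
- exact: kerL.
Qed.

Lemma smooth_wasserstein_mx : smooth_mx (U := Theta) (wasserstein_mx G p).
Proof.
apply: smooth_mulmx => //; last exact: smooth_jacobi.
apply: smooth_mulmx => //; last exact: smooth_mp_inverse_laplacian.
by apply: smooth_mx_tr => //; exact: smooth_jacobi.
Qed.

Lemma wasserstein_riemannian :
  riemannian_metric Theta (wasserstein_metric G p).
Proof.
split.
- move=> th _ c a a' b; rewrite /wasserstein_metric linearP /=.
  by rewrite !mulmxDl -!scalemxAl !mxE.
- move=> th _ a b; rewrite /wasserstein_metric -[LHS]trace_mx11 -mxtrace_tr.
  have := trmx_wasserstein_mx th; move: (wasserstein_mx G p th) => W Wt.
  by rewrite !trmx_mul trmxK Wt mulmxA trace_mx11.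
- by move=> th thT a; exact: wasserstein_metric_gt0.
- move=> a b; apply: (smooth_mulmx Theta_open _ _ 0 0); last first.
    exact: smooth_mx_cst.
  apply: smooth_mulmx => //; first exact: smooth_mx_cst.
  exact: smooth_wasserstein_mx.
Qed.

Lemma is_riemannian_gradientP f th v : Theta th ->
  is_riemannian_gradient (wasserstein_metric G p) f th v <->
  v = invmx (wasserstein_mx G p th) *m euclidean_gradient f th.
Proof.
move=> thT; have Wu := wasserstein_unitmx thT.
have gE a : wasserstein_metric G p th v a =
    \sum_(i < d) (wasserstein_mx G p th *m v) i 0 * a i 0.
  rewrite /wasserstein_metric -trmx_wasserstein_mx -trmx_mul mxE.
  by apply: eq_bigr => i _; rewrite trmx_wasserstein_mx mxE.
split=> [vP|->].
  rewrite -[LHS](mulKmx Wu); congr (_ *m _); apply/colP => k.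
  rewrite -[LHS]sum_mul_delta -gE vP -[RHS]sum_mul_delta.
  by apply: eq_bigr => i _; congr (_ * _); rewrite mxE.
move=> a; rewrite /wasserstein_metric trmx_mul trmx_inv trmx_wasserstein_mx.
rewrite -(mulmxA (euclidean_gradient f th)^T) mulVmx // mulmx1 mxE.
by apply: eq_bigr => i _; rewrite !mxE.
Qed.

Lemma riemannian_gradientE f th : Theta th ->
  riemannian_gradient (wasserstein_metric G p) f th =
  invmx (wasserstein_mx G p th) *m euclidean_gradient f th.
Proof.
move=> thT; apply/(is_riemannian_gradientP f _ thT).
have vP := (is_riemannian_gradientP f _ thT).2 erefl.
exact: getI vP.
Qed.

Lemma euclidean_gradient_comp (F : 'cV[R]_n -> R) O Fext th :
  smooth_extension F O Fext -> Theta th ->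
  euclidean_gradient (F \o p) th =
  (jacobi_mx p th)^T *m euclidean_gradient Fext (p th).
Proof.
move=> [Oopen simO FextS FextE] thT; apply/colP => j; rewrite !mxE.
rewrite (@eq_partial _ _ _ Theta_open _ (Fext \o p)) //; last first.
  by move=> y /p_simplex yS; rewrite /= FextE.
rewrite (partial_comp Oopen) //; last first.
- by move=> i; exact: derivable_smooth_map.
- exact/simO/p_simplex.
by apply: eq_bigr => i _; rewrite !mxE mulrC.
Qed.

End WassersteinMetric.

Lemma eq_solves_ode (R : realType) (d : nat) (U : set 'cV[R]_d)
    (X Y : 'cV[R]_d -> 'cV[R]_d) (T : set R) (c : R -> 'cV[R]_d) :
  (forall x, U x -> X x = Y x) -> solves_ode U X T c <-> solves_ode U Y T c.
Proof.
by move=> XY; split=> cX t Tt; have [Uc cD] := cX t Tt; split=> //;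
  rewrite ?XY // -XY.
Qed.

Theorem mainTheorem1 (R : realType) (n d : nat) (G : wgraph R n)
    (Theta : set 'cV[R]_d) (p : 'cV[R]_d -> 'cV[R]_n) (F : 'cV[R]_n -> R)
    (hG : connected_wgraph G)
    (hd : (1 <= d <= n - 1)%N)
    (hTheta : open Theta)
    (hp : forall th, Theta th -> open_simplex (p th))
    (hsmooth : smooth_map Theta p)
    (hrank : forall th, Theta th -> \rank (jacobi_mx p th) = d)
    (hF : smooth_on_simplex F) :
  let g := wasserstein_metric G p in
  let J := jacobi_mx p in
  let Gm := wasserstein_mx G p in
  [/\ riemannian_metric Theta g,
      forall th, Theta th ->
        Gm th \in unitmx /\
        exists! v, is_riemannian_gradient g (F \o p) th v,
      (forall th, Theta th ->
         riemannian_gradient g (F \o p) th =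
         invmx (Gm th) *m euclidean_gradient (F \o p) th) /\
      (forall (T : set R) (c : R -> 'cV[R]_d), open T -> is_interval T ->
         (is_gradient_flow Theta g (F \o p) T c <->
          solves_ode Theta
            (fun th => - (invmx (Gm th) *m euclidean_gradient (F \o p) th))
            T c)) &
      forall (O : set 'cV[R]_n) (Fext : 'cV[R]_n -> R),
        smooth_extension F O Fext ->
        (forall th, Theta th ->
           riemannian_gradient g (F \o p) th =
           mp_inverse ((J th)^T *m mp_inverse (laplacian G (p th)) *m J th)
             *m (J th)^T *m euclidean_gradient Fext (p th)) /\
        (forall (T : set R) (c : R -> 'cV[R]_d), open T -> is_interval T ->
           (is_gradient_flow Theta g (F \o p) T c <->
            solves_ode Theta
              (fun th => - (mp_inverse
                  ((J th)^T *m mp_inverse (laplacian G (p th)) *m J th)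
                  *m (J th)^T *m euclidean_gradient Fext (p th)))
              T c))].
Proof.
move=> g J Gm.
have GmU := wasserstein_unitmx hG hTheta hp hsmooth hrank.
have gradP := is_riemannian_gradientP hG hTheta hp hsmooth hrank (F \o p).
have gradE := riemannian_gradientE hG hTheta hp hsmooth hrank (F \o p).
have gradJ O Fext : smooth_extension F O Fext -> forall th, Theta th ->
    riemannian_gradient g (F \o p) th =
    mp_inverse ((J th)^T *m mp_inverse (laplacian G (p th)) *m J th)
      *m (J th)^T *m euclidean_gradient Fext (p th).
  move=> FextP th thT; rewrite gradE //.
  rewrite (euclidean_gradient_comp hTheta hp hsmooth FextP thT) mulmxA.
  by rewrite -/(wasserstein_mx G p th) mp_inverse_unitmx // GmU.
split.
- exact: wasserstein_riemannian.
- move=> th thT; split; first exact: GmU.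
  exists (invmx (Gm th) *m euclidean_gradient (F \o p) th); split.
    by apply/(gradP _ _ thT).
  by move=> v /(gradP _ _ thT) ->.
- split=> [th /gradE //|T c _ _].
  by apply: eq_solves_ode => th /gradE ->.
- move=> O Fext /gradJ FextE; split=> // T c _ _.
  by apply: eq_solves_ode => th /FextE ->.
Qed.
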